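(* Let $K, r, \tilde a \in \mathbb{R}$ and $\tilde b > 0$ be constants, and consider the system $$\frac{\partial u_1}{\partial t}(t,z) - \frac{\partial^2 u_1}{\partial z^2}(t,z) + K u_1(t,z) - r\tilde b\, u_2(t,z) = 0 \quad \text{and} \quad \frac{\partial u_2}{\partial t}(t,z) - \tilde a\, u_1(t,z) + \tilde b\, u_2(t,z) = 0 \quad \text{for } (t,z) \in (0,+\infty)\times(0,1),$$ $$u_1(t,0) - d(t) = u_1(t,1) = 0 \quad \text{for } t \ge 0,$$ with initial conditions $u_1[0] = u_{1,0}$, $u_2[0] = u_{2,0}$. Suppose that $$|r \tilde a| < K + \pi^2.$$ Then there exist constants $M, \gamma, \delta > 0$ such that for every $u_{1,0} \in C^0([0,1])$ with $u_{1,0}(1) = 0$, every $u_{2,0} \in C^1([0,1])$ and every $d \in C^0(\mathbb{R}_+)$ with $d(0) = u_{1,0}(0)$, for which there exists a unique pair of mappings $u_1 \in C^0(\mathbb{R}_+ \times [0,1]) \cap C^1((0,+\infty)\times[0,1])$, $u_2 \in C^1(\mathbb{R}_+\times[0,1])$ with $u_1[t] \in C^2([0,1])$ for $t>0$ satisfying the equations $\frac{\partial u_1}{\partial t} - \frac{\partial^2 u_1}{\partial z^2} + K u_1 - r\tilde b\, u_2 = 0$ and $\frac{\partial u_2}{\partial t} - \tilde a\, u_1 + \tilde b\, u_2 = 0$ on $(0,+\infty)\times(0,1)$, the boundary conditions $u_1(t,0) = d(t)$ and $u_1(t,1) = 0$ for $t \ge 0$, and the initial conditions $u_1[0] = u_{1,0}$,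 $u_2[0] = u_{2,0}$, the following inequality holds for all $t \ge 0$: $$\|u_1[t]\|_\infty + \|u_2[t]\|_\infty \le M \exp(-\delta t)\left(\|u_{1,0}\|_\infty + \|u_{2,0}\|_\infty\right) + \gamma \max_{0 \le s \le t} |d(s)|.$$
   Context: $\mathbb{R}_+ := [0,+\infty)$. All functions are real-valued. For $u : \mathbb{R}_+ \times [0,1] \to \mathbb{R}$, $u[t]$ denotes the profile at time $t \ge 0$, i.e. $(u[t])(z) = u(t,z)$ for $z \in [0,1]$. $\|f\|_\infty$ is the (essential) supremum norm of $f$ on $[0,1]$. $C^k(U)$ denotes the functions on $U$ with continuous derivatives of order up to $k$ on $U$. *)

(* Defs.v *)
From HB Require Import structures.
From mathcomp Require Export all_boot all_order all_algebra.
From mathcomp Require Export all_classical all_reals all_analysis.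
Set Implicit Arguments.
Unset Strict Implicit.
Unset Printing Implicit Defensive.
Import Order.TTheory GRing.Theory Num.Theory.
Import numFieldNormedType.Exports.
Local Open Scope classical_set_scope.
Local Open Scope ring_scope.

(* Functions on a set [D] are represented by total functions, of which only the
   values on [D] matter.  Derivatives are therefore taken relative to [D]: at an
   interior point of [D] this is the usual derivative, at an endpoint of an
   interval it is the one-sided one. *)
Definition is_derive_within (R : realType) (D : set R) (f : R -> R) (x l : R) :
  Prop := (f y - f x) / (y - x) @[y --> within D x^'] --> l.

Fixpoint Ck (R : realType) (k : nat) (D : set R) (f : R -> R) : Prop :=
  {within D, continuous f} /\
  if k is k'.+1 then
    exists2 g : R -> R,
      (forall x : R, D x -> is_derive_within D f x (g x)) & Ck k' D g
  else True.

Definition C0_2 (R : realType) (U : set (R * R)) (u : R -> R -> R) : Prop :=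
  {within U, continuous (fun p : R * R => u p.1 p.2)}.

Definition C1_2 (R : realType) (U : set (R * R)) (u : R -> R -> R) : Prop :=
  C0_2 U u /\
  exists ut uz : R -> R -> R,
    [/\ C0_2 U ut, C0_2 U uz,
        (forall t z : R, U (t, z) ->
           is_derive_within [set s | U (s, z)] (fun s => u s z) t (ut t z)) &
        (forall t z : R, U (t, z) ->
           is_derive_within [set y | U (t, y)] (u t) z (uz t z))].

Definition lebesgue01 (R : realType) :=
  mrestr (@lebesgue_measure R)
    (measurable_itv `[0%R, 1%R] : measurable (`[0%R, 1%R] : set R)).

(* The essential supremum norm on [0, 1], as an extended real. *)
Definition norm_oo (R : realType) (f : R -> R) : \bar R :=
  Lnorm (@lebesgue01 R) +oo%E (EFin \o f).

(* [u1 t] is the profile at time [t].  In the two evolution equations the point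
   is interior, so the library's two-sided derivatives are the right ones. *)
Definition is_solution (R : realType) (K r a b : R) (u10 u20 d : R -> R)
    (u1 u2 : R -> R -> R) : Prop :=
  [/\ [/\ C0_2 (`[0, +oo[ `*` `[0, 1]) u1,
          C1_2 (`]0, +oo[ `*` `[0, 1]) u1,
          C1_2 (`[0, +oo[ `*` `[0, 1]) u2 &
          forall t : R, 0 < t -> Ck 2 `[0, 1] (u1 t)],
      (forall t z : R, 0 < t -> 0 < z < 1 ->
         derive1 (fun s => u1 s z) t - derive1n 2 (u1 t) z + K * u1 t z
           - r * b * u2 t z = 0),
      (forall t z : R, 0 < t -> 0 < z < 1 ->
         derive1 (fun s => u2 s z) t - a * u1 t z + b * u2 t z = 0),
      (forall t : R, 0 <= t -> u1 t 0 = d t /\ u1 t 1 = 0) &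
      (forall z : R, 0 <= z <= 1 -> u1 0 z = u10 z /\ u2 0 z = u20 z)].

(* Uniqueness is that of mappings on [0, +oo[ x [0, 1]. *)
Definition is_unique_solution (R : realType) (K r a b : R)
    (u10 u20 d : R -> R) (u1 u2 : R -> R -> R) : Prop :=
  is_solution K r a b u10 u20 d u1 u2 /\
  forall v1 v2 : R -> R -> R, is_solution K r a b u10 u20 d v1 v2 ->
    forall t z : R, 0 <= t -> 0 <= z <= 1 -> v1 t z = u1 t z /\ v2 t z = u2 t z.

(* Main.v *)
Require Import Defs.
From mathcomp Require Import all_boot all_order all_algebra.
From mathcomp Require Import all_classical all_reals all_analysis.
From mathcomp Require Import ess_sup_inf ring lra.
Import Order.TTheory GRing.Theory Num.Theory.
Import numFieldNormedType.Exports.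
Local Open Scope classical_set_scope.
Local Open Scope ring_scope.

(* Choose [w < pi] with [|r a| < K + w^2].  The function [cos (w (z - 1/2))] is
   positive on [0, 1] and an eigenfunction of the Laplacian for [- w^2], so for
   suitable [C, delta > 0] and [G s = N exp (- delta s) + D + eps] the pair
   [(G, C G)] times this eigenfunction is a strict supersolution.  At a maximum
   point over [0, t] x [0, 1] of the two ratios of [|u1|] and [|u2|] to the
   supersolution, a ratio above 1 contradicts either the initial and boundary
   data or one of the two equations.  Finally [eps] tends to 0. *)

(** * Derivatives at interior points and at maxima *)

Lemma is_derive_within_nbhs {R : realType} (D : set R) (f : R -> R) (x l : R) :
  nbhs x D -> is_derive_within D f x l -> is_derive x 1 f l.
Proof.
move=> xD fl.
have {}fl : (f y - f x) / (y - x) @[y --> x^'] --> l.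
  apply: cvg_trans fl; apply: cvg_app => A.
  by move: xD; apply: filterS2 => y Dy A'y yx; apply: A'y.
(* The substitution [y = h + x] turns the quotient in [y] into the increment quotient in [h] behind
   [is_derive]. *)
have dfl : h^-1 *: ((f \o shift x) (h *: 1) - f x) @[h --> 0^'] --> l.
  move=> A /fl /nbhs_ballP [e e0 eA]; apply/nbhs_ballP; exists e => // h he h0.
  have := eA (h + x); rewrite /= -ball_normE /= addrK.
  rewrite opprD addrCA subrr addr0 normrN.
  move: he; rewrite /= -ball_normE /= sub0r normrN => he /(_ he).
  rewrite -subr_eq0 addrK => /(_ h0).
  by rewrite /GRing.scale /= mulr1 mulrC.
apply: DeriveDef; first by apply/cvg_ex; exists l.
exact/cvg_lim.
Unshelve. all: by end_near. Qed.

(** Quotients from the left are non-negative, and the derivative is their limit. Only the left side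
    is considered because the comparison runs up to a final time, beyond which no bound is
    available. *)
Lemma is_derive_left_max {R : realType} (f : R -> R) (x l e : R) :
  0 < e -> (forall y, x - e < y < x -> f y <= f x) ->
  is_derive x 1 f l -> 0 <= l.
Proof.
move=> e0 fmax [df <-]; rewrite ['D_1 f x]cvg_at_leftE //.
apply: limr_ge.
  have cvgf := cvg_at_leftE (fun h => h^-1 *: ((f \o shift x) (h *: 1) - f x)).
  rewrite -cvgf //.
  apply: cvg_trans df; apply: cvg_app.
  by move=> A [d d0 Ad]; exists d => // y xy ylt0; apply: Ad => //; exact/ltr0_neq0.
near=> h; apply: mulr_le0.
  by rewrite invr_le0; apply: ltW; near: h; exists 1 => /=.
rewrite subr_le0 [_%:A]mulr1; apply: fmax; near: h.
exists e => // h; rewrite /= distrC subr0 => he h0.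
rewrite gtrDr h0 andbT -ltrBlDr addrAC subrr add0r.
by rewrite ltrNl -(ltr0_norm h0).
Unshelve. all: by end_near. Qed.

(** The first derivative vanishes at [c]. If [l] were positive, [df] would be positive just to the
    right of [c], and the mean value theorem would give a value above [f c]. *)
Lemma second_derivative_at_max {R : realType} (f df : R -> R) (a b c l : R) :
  a < c < b -> (forall x, a < x < b -> is_derive x 1 f (df x)) ->
  (forall x, a < x < b -> f x <= f c) -> is_derive c 1 df l -> l <= 0.
Proof.
move=> acb fdf fmax dfl; have /andP[ac cb] := acb; have ab := lt_trans ac cb.
have dfc0 : df c = 0.
  have fc : is_derive c 1 f 0.
    apply: (derive1_at_max (ltW ab)); last by move=> t; rewrite in_itv; exact: fmax.
      by move=> t; rewrite in_itv => /fdf [].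
    by rewrite in_itv.
  have [_ <-] := fdf c acb; by have [_ ->] := fc.
rewrite leNgt; apply/negP => l0.
have {l0} : \forall h \near 0^', 0 < h^-1 *: ((df \o shift c) (h *: 1) - df c).
  have [ex dl] := dfl; have := ex; rewrite -dl in l0.
  by move=> /cvgr_gt; apply.
move=> /nbhs_ballP [e /= e0 he].
have [d [d0 de dlt]] : exists d, [/\ 0 < d, d < e & c + d < b].
  exists (Num.min e (b - c) / 2); have m0 : 0 < Num.min e (b - c) by rewrite lt_min e0 subr_gt0.
  have : Num.min e (b - c) <= e by rewrite ge_min lexx.
  have : Num.min e (b - c) <= b - c by rewrite ge_min lexx orbT.
  by move: (Num.min _ _) m0 => m *; split; lra.
have cd : c < c + d by lra.
have fd x : x \in `]c, c + d[ -> is_derive x 1 f (df x).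
  by rewrite in_itv /= => /andP[? ?]; apply: fdf; apply/andP; split; lra.
have [|y] := MVT cd fd.
  apply: derivable_within_continuous => x; rewrite in_itv /= => /andP[? ?].
  by have [] // := fdf x; apply/andP; split; lra.
rewrite in_itv /= => /andP[cy ycd] fcd.
have fle : f (c + d) - f c <= 0 by rewrite subr_le0; apply: fmax; lra.
have := he (y - c); rewrite /= -ball_normE /= sub0r normrN.
rewrite ger0_norm; last lra.
have -> : y - c < e by lra.
move=> /(_ isT); have -> : y - c != 0 by rewrite subr_eq0 gt_eqF.
move=> /(_ isT); rewrite /GRing.scale /= mulr1 subrK dfc0 subr0 pmulr_rgt0; last first.
  by rewrite invr_gt0; lra.
by nra.
Qed.

(** * The positive eigenfunction of the Laplacian *)

(* The eigenfunction is normalised so that [1 <= profile w] on [0, 1]. *)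
Definition profile {R : realType} (w z : R) : R := cos (w * (z - 2^-1)) / cos (w / 2).

Lemma cos_half_gt0 {R : realType} (w : R) : 0 < w < pi -> 0 < cos (w / 2).
Proof. by move=> /andP[w0 wpi]; apply: cos_gt0_pihalf; apply/andP; split; lra. Qed.

(** On [0, 1] the argument of the cosine is at most [w / 2 < pi / 2] in absolute value, and the
    cosine is even and decreasing on [0, pi]. *)
Lemma profile_ge1 {R : realType} (w z : R) : 0 < w < pi -> 0 <= z <= 1 -> 1 <= profile w z.
Proof.
move=> wpi /andP[z0 z1]; rewrite /profile ler_pdivlMr ?cos_half_gt0 // mul1r.
have /andP[w0 w1] := wpi.
rewrite -[cos (w * (z - _))]cos_norm.
have /andP[n0 n1] : 0 <= `|w * (z - 2^-1)| <= w / 2.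
  rewrite normr_ge0 /= ler_norml; apply/andP; split; nra.
have ltc := @ltr_cos _ (w / 2) `|w * (z - 2^-1)|.
rewrite leNgt ltc ?in_itv /= -?leNgt //; apply/andP; split; lra.
Qed.

Lemma profile_le {R : realType} (w z : R) : 0 < w < pi -> profile w z <= (cos (w / 2))^-1.
Proof.
move=> wpi; rewrite /profile ler_pdivrMr ?cos_half_gt0 // mulVf ?cos_le1 //.
by rewrite gt_eqF // cos_half_gt0.
Qed.

Definition dprofile {R : realType} (w z : R) : R :=
  - w * sin (w * (z - 2^-1)) / cos (w / 2).

Lemma is_derive_profile {R : realType} (w z : R) : is_derive z 1 (profile w) (dprofile w z).
Proof.
rewrite /profile /dprofile; apply: is_derive_eq.
rewrite /GRing.scale /=; ring.
Qed.

Lemma is_derive_dprofile {R : realType} (w z : R) :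
  is_derive z 1 (dprofile w) (- w ^+ 2 * profile w z).
Proof.
rewrite /profile /dprofile; apply: is_derive_eq.
rewrite /GRing.scale /=; ring.
Qed.

(** * Continuity in one variable, and signs *)

Lemma C0_2_slice {R : realType} (U : set (R * R)) (I : set R) (F : R -> R -> R) (t : R) :
  (forall z, I z -> U (t, z)) -> C0_2 U F -> {within I, continuous (F t)}.
Proof.
move=> IU /subspace_continuousP cF; apply/subspace_continuousP => z Iz.
apply: cvg_trans (cF _ (IU _ Iz)) => A /= FA.
have [[P Q] /= [tP zQ] PQA] := FA.
apply: filterS zQ => y Qy Iy; apply: (PQA (t, y)) => /=; last exact: IU.
by split => //; exact: nbhs_singleton.
Qed.

(** Each end value is a one-sided limit of zeros. This carries an equation from the open interval to
    the closed one. *)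
Lemma within_itv_eq0 {R : realType} (f : R -> R) (a b : R) : a < b ->
  {within `[a, b], continuous f} -> (forall x, a < x < b -> f x = 0) ->
  forall x, a <= x <= b -> f x = 0.
Proof.
move=> ab /(continuous_within_itvP _ ab)[_ fa fb] f0 x.
have zero_cvg (F : set_system R) (FF : ProperFilter F) l :
    f y @[y --> F] --> l -> (\forall y \near F, a < y < b) -> l = 0.
  move=> fl Fab; apply: (cvg_unique _ fl) => //.
  apply: cvg_near_cst; apply: filterS Fab => y; exact: f0.
move=> /andP[ax xb].
have [xa|xa] := leP x a.
  have -> : x = a by lra.
  apply: (zero_cvg _ _ _ fa); near=> y; apply/andP; split; near: y.
    exact: nbhs_right_gt.
  exact: nbhs_right_lt.
have [bx|bx] := leP b x; last by apply: f0; rewrite xa.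
have -> : x = b by lra.
apply: (zero_cvg _ _ _ fb); near=> y; apply/andP; split; near: y.
  exact: nbhs_left_gt.
exact: nbhs_left_lt.
Unshelve. all: by end_near. Qed.

(** Since [|u|] need not be differentiable, the sign [s] is frozen at a contact point: [s * u] is
    differentiable, equals [|u|] there and nowhere exceeds it. *)
Lemma norm_sign {R : realType} (x : R) : exists2 s : R, `|s| = 1 & s * x = `|x|.
Proof.
have [x0|x0] := leP 0 x; [exists 1 | exists (-1)].
- by rewrite normr1.
- by rewrite mul1r ger0_norm.
- by rewrite normrN1.
- by rewrite mulN1r ltr0_norm.
Qed.

Lemma sign_mul_le {R : realType} (s x : R) : `|s| = 1 -> s * x <= `|x|.
Proof. by move=> s1; rewrite -[leRHS]mul1r -s1 -normrM ler_norm. Qed.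

(** * The differential equations at a contact point *)

Section Solution.
Context {R : realType} (K r a b : R) (u10 u20 d : R -> R) (u1 u2 : R -> R -> R).
Hypothesis sol : is_solution K r a b u10 u20 d u1 u2.

Lemma solution_u1_derivatives (t z : R) : 0 < t -> 0 < z < 1 ->
  exists (ut : R) (uz uzz : R -> R),
    [/\ is_derive t 1 (u1 ^~ z) ut,
        forall y : R, 0 < y < 1 -> is_derive y 1 (u1 t) (uz y),
        forall y : R, 0 < y < 1 -> is_derive y 1 uz (uzz y) &
        ut - uzz z + K * u1 t z - r * b * u2 t z = 0].
Proof.
have [[_ [_ [u1t [u1z [_ _ u1tP _]]]] _ u1C2] eq1 _ _ _] := sol.
move=> t0 z01.
have [_ [uz uzP [_ [uzz uzzP _]]]] := u1C2 t t0.
have itv_nbhs (y : R) : 0 < y < 1 -> nbhs y `[0, 1]%classic.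
  move=> y01; have := @near_in_itvoo R 0 1 y; rewrite in_itv => /(_ y01).
  by apply: filterS => x /=; rewrite !in_itv /= => /andP[/ltW -> /ltW ->].
have duz (y : R) : 0 < y < 1 -> is_derive y 1 (u1 t) (uz y).
  move=> y01; apply: is_derive_within_nbhs (itv_nbhs _ y01) _; apply: uzP.
  by rewrite /= in_itv /=; case/andP: y01 => /ltW -> /ltW ->.
have duzz (y : R) : 0 < y < 1 -> is_derive y 1 uz (uzz y).
  move=> y01; apply: is_derive_within_nbhs (itv_nbhs _ y01) _; apply: uzzP.
  by rewrite /= in_itv /=; case/andP: y01 => /ltW -> /ltW ->.
have dut : is_derive t 1 (u1 ^~ z) (u1t t z).
  apply: is_derive_within_nbhs (u1tP t z _); last first.
    by split; rewrite /= in_itv /= ?t0 //; case/andP: z01 => /ltW -> /ltW ->.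
  have := lt_nbhsr t0; apply: filterS => x x0.
  by split; rewrite /= in_itv /= ?x0 //; case/andP: z01 => /ltW -> /ltW ->.
exists (u1t t z), uz, uzz; split => //.
rewrite -(eq1 t z t0 z01) derive1E derive_val.
congr (_ - _ + _ - _); rewrite /= derive1E.
(* [derive1n 2] differentiates [derive1 (u1 t)], which agrees with [uz] on ]0, 1[. That is a
   neighbourhood of [z], so the derivatives at [z] coincide. *)
have [_ <-] := duzz z z01; apply: near_eq_derive.
have := @near_in_itvoo R 0 1 z; rewrite in_itv => /(_ z01).
apply: filterS => x /=; rewrite in_itv /= => x01.
by rewrite derive1E; have [_ ->] := duz x x01.
Qed.

(* The equation is given for [0 < z < 1] only; it extends to the end points
   because both of its sides are continuous in [z]. *)
Lemma solution_u2_derivative (t z : R) : 0 < t -> 0 <= z <= 1 ->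
  is_derive t 1 (u2 ^~ z) (a * u1 t z - b * u2 t z).
Proof.
have [[cu1 _ [cu2 [u2t [_ [cu2t _ u2tP _]]]] _] _ eq2 _ _] := sol.
move=> t0 z01.
have dut (y : R) : 0 <= y <= 1 -> is_derive t 1 (u2 ^~ y) (u2t t y).
  move=> y01; apply: is_derive_within_nbhs (u2tP t y _); last first.
    by split; rewrite /= in_itv /= ?(ltW t0).
  have := lt_nbhsr t0; apply: filterS => x /ltW x0.
  by split; rewrite /= in_itv /= ?x0.
pose f y := u2t t y - (a * u1 t y - b * u2 t y).
suff /(_ z z01) /eqP : forall y, 0 <= y <= 1 -> f y = 0.
  by rewrite subr_eq0 => /eqP <-; exact: dut.
apply: within_itv_eq0 => // [|y y01].
  have slice F : C0_2 (`[0, +oo[ `*` `[0, 1]) F -> {within `[0, 1], continuous (F t)}.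
    by apply: C0_2_slice => y y01; split; rewrite //= in_itv /= (ltW t0).
  move=> y; apply: cvgB; first exact: slice.
  by apply: cvgB; apply: cvgM; (exact: cvg_cst || exact: slice).
have y01' : 0 <= y <= 1 by case/andP: y01 => /ltW -> /ltW ->.
have := eq2 t y t0 y01; rewrite derive1E; have [_ ->] := dut y y01'; rewrite /f; lra.
Qed.

Context (w C delta t0 z0 : R) (G : R -> R) (dG : R).
Hypotheses (wpi : 0 < w < pi) (b0 : 0 < b) (t0_gt0 : 0 < t0).
Hypotheses (dGP : is_derive t0 1 G dG) (dG_ge : - delta * G t0 <= dG).
Hypothesis G0 : 0 < G t0.

(** Let [B] be [profile w z0]. Over earlier times and over space, [s * u1 - G * profile w] is
    maximal at the contact point, so [dG * B <= s * ut] and [s * uzz z0 <= - w ^+ 2 * G t0 * B]. The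
    equation then gives [s * ut <= (|r| * b * C - K - w ^+ 2) * G t0 * B], which is below
    [- delta * G t0 * B] and hence below [dG * B]. *)
Lemma u1_no_touch : `|r| * b * C < K + w ^+ 2 - delta -> 0 < z0 < 1 ->
  (forall t z : R, 0 <= t <= t0 -> 0 <= z <= 1 -> `|u1 t z| <= G t * profile w z) ->
  `|u2 t0 z0| <= C * G t0 * profile w z0 ->
  `|u1 t0 z0| = G t0 * profile w z0 -> False.
Proof.
move=> KC z01 le1 le2 eq1.
have z01' : 0 <= z0 <= 1 by case/andP: z01 => /ltW -> /ltW ->.
have [s s1 su1] := norm_sign (u1 t0 z0).
have [ut [uz [uzz [dut duz duzz eqn]]]] := solution_u1_derivatives _ _ t0_gt0 z01.
have B1 := profile_ge1 _ _ wpi z01'.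
have time_ge : 0 <= s * ut - dG * profile w z0.
  apply: (@is_derive_left_max _ (fun t => s * u1 t z0 - G t * profile w z0) t0 _ t0) => //.
    move=> t /andP[tl tr]; rewrite su1 eq1 subrr subr_le0.
    by apply: le_trans (sign_mul_le _ _ s1) (le1 _ _ _ z01'); lra.
  by apply: is_derive_eq; rewrite /GRing.scale /=; ring.
have space_le : s * uzz z0 + G t0 * w ^+ 2 * profile w z0 <= 0.
  apply: (@second_derivative_at_max _ (fun z => s * u1 t0 z - G t0 * profile w z)
    (fun z => s * uz z - G t0 * dprofile w z) 0 1 z0) => //.
  - move=> x /duz ?; have ? := is_derive_profile w x.
    by apply: is_derive_eq; rewrite /GRing.scale /=; ring.
  - move=> x /andP[x0 x1]; rewrite su1 eq1 subrr subr_le0.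
    by apply: le_trans (sign_mul_le _ _ s1) (le1 _ _ _ _);
      rewrite ?(ltW t0_gt0) ?lexx ?(ltW x0) ?(ltW x1).
  - have ? := duzz _ z01; have ? := is_derive_dprofile w z0.
    by apply: is_derive_eq; rewrite /GRing.scale /=; ring.
have r_le : s * (r * b * u2 t0 z0) <= `|r| * b * (C * G t0 * profile w z0).
  apply: le_trans (sign_mul_le _ _ s1) _; rewrite !normrM (gtr0_norm b0).
  by apply: ler_wpM2l => //; rewrite mulr_ge0 // ltW.
have GB : 0 < G t0 * profile w z0 by rewrite mulr_gt0 //; lra.
have {}eqn : s * ut = s * uzz z0 - K * (s * u1 t0 z0) + s * (r * b * u2 t0 z0).
  by rewrite -[LHS]subr0 -(mulr0 s) -eqn; ring.
rewrite su1 eq1 in eqn.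
have : 0 < (K + w ^+ 2 - delta - `|r| * b * C) * (G t0 * profile w z0).
  by rewrite mulr_gt0 // subr_gt0.
have : - delta * G t0 * profile w z0 <= dG * profile w z0.
  by rewrite ler_wpM2r //; lra.
by lra.
Qed.

(** The same argument in time alone: the second equation has no diffusion term, so [z0] may be an
    end point. With [B] as [profile w z0], the time derivative of [s * u2] is at least [C * dG * B]
    but at most [(|a| - b * C) * G t0 * B], which is below [- delta * C * G t0 * B]. *)
Lemma u2_no_touch : 0 < C -> `|a| < (b - delta) * C -> 0 <= z0 <= 1 ->
  (forall t : R, 0 <= t <= t0 -> `|u2 t z0| <= C * G t * profile w z0) ->
  `|u1 t0 z0| <= G t0 * profile w z0 ->
  `|u2 t0 z0| = C * G t0 * profile w z0 -> False.
Proof.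
move=> C0 aC z01 le2 le1 eq2.
have [s s1 su2] := norm_sign (u2 t0 z0).
have du := solution_u2_derivative _ _ t0_gt0 z01.
have B1 := profile_ge1 _ _ wpi z01.
have time_ge : 0 <= s * (a * u1 t0 z0 - b * u2 t0 z0) - C * dG * profile w z0.
  apply: (@is_derive_left_max _ (fun t => s * u2 t z0 - C * G t * profile w z0) t0 _ t0) => //.
    move=> t /andP[tl tr]; rewrite su2 eq2 subrr subr_le0.
    by apply: le_trans (sign_mul_le _ _ s1) (le2 _ _); lra.
  by apply: is_derive_eq; rewrite /GRing.scale /=; ring.
have a_le : s * (a * u1 t0 z0) <= `|a| * (G t0 * profile w z0).
  by apply: le_trans (sign_mul_le _ _ s1) _; rewrite normrM ler_wpM2l.
have GB : 0 < G t0 * profile w z0 by rewrite mulr_gt0 //; lra.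
have : 0 < ((b - delta) * C - `|a|) * (G t0 * profile w z0).
  by rewrite mulr_gt0 // subr_gt0.
have : C * (- delta * G t0 * profile w z0) <= C * (dG * profile w z0).
  by rewrite ler_wpM2l ?(ltW C0) // ler_wpM2r //; lra.
have : s * (b * u2 t0 z0) = b * (C * G t0 * profile w z0) by rewrite -eq2 -su2; ring.
by lra.
Qed.

End Solution.

(** * Comparison with the supersolution *)

Lemma continuous_profile {R : realType} (w : R) : continuous (profile w).
Proof.
move=> z; apply: differentiable_continuous; apply/derivable1_diffP.
by have [] := is_derive_profile w z.
Qed.

Lemma comparison {R : realType} (K r a b : R) (u10 u20 d : R -> R)
    (u1 u2 : R -> R -> R) (w C delta T : R) (G dG : R -> R) :
  is_solution K r a b u10 u20 d u1 u2 ->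
  0 < w < pi -> 0 < b -> 0 < C ->
  `|r| * b * C < K + w ^+ 2 - delta -> `|a| < (b - delta) * C ->
  (forall t : R, is_derive t 1 G (dG t)) ->
  (forall t, 0 <= t -> 0 < G t) -> (forall t, 0 <= t -> - delta * G t <= dG t) ->
  (forall z, 0 <= z <= 1 -> `|u10 z| < G 0 /\ `|u20 z| < C * G 0) ->
  (forall t, 0 <= t <= T -> `|d t| < G t) ->
  forall t z, 0 <= t <= T -> 0 <= z <= 1 ->
    `|u1 t z| <= G t * profile w z /\ `|u2 t z| <= C * G t * profile w z.
Proof.
move=> sol wpi b0 C0 KC aC dGP G0 dG_ge init bnd t z tT z01.
have [[cu1 _ [cu2 _] _] _ _ bc ic] := sol.
pose A : set (R * R) := `[0, T] `*` `[0, 1].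
have AP s y : 0 <= s <= T -> 0 <= y <= 1 -> A (s, y).
  by move=> sT y01; split; rewrite /= in_itv.
pose P1 (p : R * R) := G p.1 * profile w p.2.
pose P2 (p : R * R) := C * G p.1 * profile w p.2.
have P1_gt0 p : A p -> 0 < P1 p.
  case: p => s y [/=]; rewrite !in_itv /= => /andP[s0 _] y01.
  by rewrite mulr_gt0 ?G0 // (lt_le_trans ltr01) // profile_ge1.
have P2E p : P2 p = C * P1 p by rewrite /P2 /P1 mulrA.
have P2_gt0 p : A p -> 0 < P2 p by move=> /P1_gt0 ?; rewrite P2E mulr_gt0.
(* Both ratios enter one maximum, so that a single multiple [m] bounds both components, as the
   coupling terms require. *)
pose H p := Num.max (`|u1 p.1 p.2| / P1 p) (`|u2 p.1 p.2| / P2 p).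
have cG : continuous G.
  move=> s; apply: differentiable_continuous; apply/derivable1_diffP.
  by have [] := dGP s.
have cP1 : continuous P1.
  move=> p; apply: cvgM.
    by apply: (@continuous_comp _ _ _ fst G); [exact: cvg_fst | exact: cG].
  by apply: (@continuous_comp _ _ _ snd (profile w)); [exact: cvg_snd | exact: continuous_profile].
have AU : A `<=` `[0, +oo[ `*` `[0, 1].
  by move=> [s y] [/=]; rewrite !in_itv /= => /andP[-> _] ->.
have quot (u : R -> R -> R) (P : R * R -> R) : C0_2 (`[0, +oo[ `*` `[0, 1]) u ->
    continuous P -> (forall p, A p -> 0 < P p) ->
    {within A, continuous (fun p => `|u p.1 p.2| / P p)}.
  move=> /(continuous_subspaceW AU)/subspace_continuousP cu cP P_gt0.
  apply/subspace_continuousP => p Ap; apply: cvgM.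
    by apply: cvg_norm; exact: cu.
  apply: cvgV; first by rewrite gt_eqF // P_gt0.
  by apply: cvg_trans (cP p); apply: cvg_app; exact: cvg_within.
have cH : {within A, continuous H}.
  have c1 := quot u1 P1 cu1 cP1 P1_gt0.
  have cP2 : continuous P2.
    rewrite (_ : P2 = fun p => C * P1 p); last by apply/funext.
    by move=> p; apply: cvgM; [exact: cvg_cst | exact: cP1].
  have c2 := quot u2 P2 cu2 cP2 P2_gt0.
  exact: (@max_fun_continuous _ (subspace A) R _ _ c1 c2).
have cA : compact A by apply: compact_setX; exact: segment_compact.
have [|[t0 z0] /set_mem Ac Hmax] := compact_EVT_max _ cA cH.
  by exists (t, z); exact: AP.
set m := H (t0, z0) in Hmax.
have bound1 p : A p -> `|u1 p.1 p.2| <= m * P1 p.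
  move=> Ap; rewrite -ler_pdivrMr ?P1_gt0 //.
  by apply: le_trans (Hmax p (mem_set Ap)); rewrite le_max lexx.
have bound2 p : A p -> `|u2 p.1 p.2| <= m * P2 p.
  move=> Ap; rewrite -ler_pdivrMr ?P2_gt0 //.
  by apply: le_trans (Hmax p (mem_set Ap)); rewrite le_max lexx orbT.
have [m1|m1] := leP m 1.
  have Atz := AP _ _ tT z01; split.
    apply: le_trans (bound1 _ Atz) _; rewrite -[leRHS]mul1r.
    by rewrite ler_pM2r // P1_gt0.
  apply: le_trans (bound2 _ Atz) _; rewrite -[leRHS]mul1r.
  by rewrite ler_pM2r // P2_gt0.
exfalso.
have [t0T z001] : 0 <= t0 <= T /\ 0 <= z0 <= 1.
  by case: Ac; rewrite /= !in_itv.
have /andP[t0_ge0 t0_leT] := t0T.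
have m0 : 0 < m by lra.
have Gt0 := G0 _ t0_ge0.
have B1 := profile_ge1 _ _ wpi z001.
(* As [m] exceeds 1 and [profile w] is at least 1, the contact height lies above [G t0], whereas the
   initial and boundary data lie below it. *)
have G_lt : G t0 < m * P1 (t0, z0).
  have GB : G t0 <= P1 (t0, z0) by rewrite /P1 /= ler_peMr // ltW.
  by have : 0 < (m - 1) * P1 (t0, z0); [rewrite mulr_gt0 ?P1_gt0 // subr_gt0 | lra].
(* The differential inequality for [G] is homogeneous, so [m * G] satisfies it too; this multiple
   touches one component at [(t0, z0)]. *)
have dmG : is_derive t0 1 (fun t => m * G t) (m * dG t0).
  have ? := dGP t0.
  by apply: is_derive_eq; rewrite /GRing.scale /=; ring.
have mdG_ge : - delta * (m * G t0) <= m * dG t0.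
  by rewrite mulrCA ler_pM2l // dG_ge.
have mG0 : 0 < m * G t0 by rewrite mulr_gt0.
have le1 s y : 0 <= s <= t0 -> 0 <= y <= 1 -> `|u1 s y| <= m * G s * profile w y.
  move=> /andP[s0 st0] y01; rewrite -mulrA; apply: (bound1 (s, y)).
  by apply: AP => //; rewrite s0 (le_trans st0).
have le2 s y : 0 <= s <= t0 -> 0 <= y <= 1 -> `|u2 s y| <= C * (m * G s) * profile w y.
  move=> /andP[s0 st0] y01.
  rewrite (_ : C * _ * _ = m * P2 (s, y)); last by rewrite /P2 /=; ring.
  by apply: (bound2 (s, y)); apply: AP => //; rewrite s0 (le_trans st0).
have t0t0 : 0 <= t0 <= t0 by rewrite t0_ge0 lexx.
(* Contact at time 0 would put an initial value above [G 0], or above [C * G 0], against the strict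
   initial bounds. *)
have t0_gt0 (e : `|u1 t0 z0| = m * P1 (t0, z0) \/ `|u2 t0 z0| = m * P2 (t0, z0)) : 0 < t0.
  rewrite lt_neqAle t0_ge0 andbT; apply/eqP => t00.
  have [i1 i2] := init _ z001; have [j1 j2] := ic _ z001.
  move: e; rewrite P2E -t00 j1 j2 t00 => -[] e.
    by move: i1; rewrite e -[X in G X]t00 in G_lt * => ?; lra.
  have : C * G t0 < C * (m * P1 (t0, z0)) by rewrite ltr_pM2l.
  by move: i2; rewrite e t00; lra.
have [m_eq|m_eq] : m = `|u1 t0 z0| / P1 (t0, z0) \/ m = `|u2 t0 z0| / P2 (t0, z0).
  by rewrite /m /H /=; case: leP => _; [right | left].
- have e1 : `|u1 t0 z0| = m * P1 (t0, z0).
    by rewrite m_eq divfK // gt_eqF // P1_gt0.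
  have t0p := t0_gt0 (or_introl e1).
  (* At [z0 = 0] the value is [d t0], smaller than [G t0] in absolute value; at [z0 = 1] it is 0,
     while the contact height is positive. *)
  have z0_int : 0 < z0 < 1.
    have [bc0 bc1] := bc _ t0_ge0; have /andP[z0_ge0 z0_le1] := z001.
    rewrite !lt_neqAle z0_ge0 z0_le1 !andbT; apply/andP; split; apply/eqP => z0E.
      by have := bnd _ t0T; rewrite -bc0 z0E e1; lra.
    by have := e1; rewrite z0E bc1 normr0 -z0E; lra.
  apply: (u1_no_touch _ _ _ _ _ _ _ _ _ sol _ C _ _ _ _ _ wpi b0 t0p dmG mdG_ge mG0 KC z0_int le1).
    exact: le2.
  by rewrite e1 /P1 /= mulrA.
- have e2 : `|u2 t0 z0| = m * P2 (t0, z0).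
    by rewrite m_eq divfK // gt_eqF // P2_gt0.
  have t0p := t0_gt0 (or_intror e2).
  apply: (u2_no_touch _ _ _ _ _ _ _ _ _ sol _ C _ _ z0 _ _ wpi t0p dmG mdG_ge mG0 C0 aC z001).
  + by move=> s st; exact: le2.
  + exact: le1.
  + by rewrite e2 /P2 /=; ring.
Qed.

(** * Essential suprema and pointwise bounds *)

Lemma norm_oo_le {R : realType} (f : R -> R) (c : R) :
  (forall z, 0 <= z <= 1 -> `|f z| <= c) -> (norm_oo f <= c%:E)%E.
Proof.
(* On a space of measure zero the norm would be 0 by definition; that branch asks only for [0 <= c],
   read off at [z = 0]. *)
move=> fc; rewrite /norm_oo unlock; case: ifPn => _; last first.
  by rewrite lee_fin (le_trans _ (fc 0 _)) // lexx ler01.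
(* The bound may fail off [0, 1], which is a null set for the restricted measure. *)
apply/ess_supP; exists (~` `[0, 1]%classic); split.
- exact: measurableC.
- suff : lebesgue_measure (~` `[0, 1] `&` `[0, 1]) = 0 :> \bar R by [].
  by rewrite setICl measure0.
- by move=> z /= zc z01; apply: zc; rewrite lee_fin; apply: fc; rewrite in_itv in z01.
Qed.

(** By continuity, a value above the essential supremum would persist on a nondegenerate interval
    inside [0, 1], and that interval would lie in a null set. *)
Lemma norm_oo_ge {R : realType} (f : R -> R) (z : R) :
  {within `[0, 1], continuous f} -> 0 <= z <= 1 -> (`|f z|%:E <= norm_oo f)%E.
Proof.
move=> /subspace_continuousP cf z01.
have zI : `[0, 1]%classic z by rewrite /= in_itv.
have I_gt0 : (0 < lebesgue_measure ([set: R] `&` `[0%R, 1%R]))%E.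
  by rewrite setTI lebesgue_measure_itv /= lte_fin ltr01 sube0 lte01.
rewrite /norm_oo unlock ifT //.
rewrite leNgt; apply/negP => lt.
have [N [mN N0 fN]] := ess_sup_ge (@lebesgue01 R) (abse \o (EFin \o f)).
set S := ess_sup _ _ in lt fN.
have S0 : (0 <= S)%E.
  have := Lnorm_ge0 (@lebesgue01 R) +oo%E (EFin \o f).
  by rewrite unlock ifT.
have SE : S = (fine S)%:E by rewrite fineK // ge0_fin_numE // (lt_trans lt) // ltry.
rewrite SE lte_fin in lt.
have : nbhs z [set x | `[0, 1]%classic x -> fine S < `|f x|].
  exact: (cvgr_gt _ (cvg_norm (cf z zI)) _ lt).
move=> /nbhs_ballP[e /= e0 he].
(* The point [z] may be an end point, so the neighbourhood is cut off at 0 and 1; it keeps positive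
   length. *)
pose l := Num.max 0 (z - e); pose u := Num.min 1 (z + e).
have /andP[z0 z1] := z01.
have lu : l < u by rewrite /l /u lt_min !gt_max; apply/andP; split; apply/andP; split; lra.
have sub : `]l, u[%classic `<=` N `&` `[0, 1].
  move=> x; rewrite /= in_itv /= gt_max lt_min => /andP[/andP[x0 xe] /andP[x1 ex]].
  have xI : `[0, 1]%classic x by rewrite /= in_itv /= !ltW.
  split; last by [].
  apply: fN => /=; rewrite SE lee_fin; apply/negP; rewrite -ltNge.
  by apply: he => //; rewrite -ball_normE /= ltr_norml; apply/andP; split; lra.
have : (lebesgue_measure `]l, u[%classic <= lebesgue_measure (N `&` `[0%R, 1%R]))%E.
  by apply: le_measure; rewrite ?inE //; exact: measurableI.
have -> : (lebesgue_measure (N `&` `[0%R, 1%R]) = 0 :> \bar R)%E by exact: N0.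
by rewrite lebesgue_measure_itv /= lte_fin lu -EFinB lee_fin; lra.
Qed.

(** * Choice of the constants *)

Lemma exists_weights {R : realType} (K r a b : R) : 0 < b ->
  `|r * a| < K + pi ^+ 2 ->
  exists w C delta : R, [/\ 0 < w < pi, 0 < C, 0 < delta,
    `|r| * b * C < K + w ^+ 2 - delta & `|a| < (b - delta) * C].
Proof.
move=> b0 hK.
have [w w0pi hw] : exists2 w : R, 0 < w < pi & `|r * a| < K + w ^+ 2.
  have pi0 := pi_gt0 R; have pi2 : 0 < (pi : R) ^+ 2 by rewrite exprn_gt0.
  (* [w ^+ 2] will be the midpoint of [x] and [pi ^+ 2]. The truncation at 0 keeps it positive
     however large [K] is. *)
  pose x := Num.max (`|r * a| - K) 0.
  have x0 : 0 <= x by rewrite le_max lexx orbT.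
  have xge : `|r * a| - K <= x by rewrite le_max lexx.
  have xlt : x < pi ^+ 2 by rewrite gt_max pi2 andbT; lra.
  have w2 : Num.sqrt ((x + pi ^+ 2) / 2) ^+ 2 = (x + pi ^+ 2) / 2 by rewrite sqr_sqrtr //; lra.
  exists (Num.sqrt ((x + pi ^+ 2) / 2)); last by rewrite w2; lra.
  rewrite sqrtr_gt0; apply/andP; split; first lra.
  by rewrite -(@ltr_pXn2r _ 2) ?nnegrE ?sqrtr_ge0 ?(ltW pi0) // w2; lra.
rewrite normrM in hw.
set q := `|r| * b; have q0 : 0 <= q by rewrite mulr_ge0 // ltW.
set gap := K + w ^+ 2 - `|r| * `|a|; have gap0 : 0 < gap by rewrite subr_gt0.
(* [C] must exceed [|a| / b] for the second equation, yet stay small enough for the first. The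
   excess [eta] satisfies [q * eta < gap / 2]; the summand 1 covers [q = 0]. *)
pose eta := gap / (2 * (q + 1)).
have eta0 : 0 < eta by rewrite divr_gt0 // mulr_gt0 //; lra.
have etaE : eta * (2 * (q + 1)) = gap by rewrite divfK // gt_eqF // mulr_gt0 //; lra.
pose C := `|a| / b + eta.
have C0 : 0 < C by rewrite ltr_wpDl // divr_ge0 // ltW.
have bC : b * C = `|a| + b * eta by rewrite /C; field; rewrite gt_eqF.
have qC : q * C = `|r| * `|a| + q * eta by rewrite /q -mulrA bC; ring.
have gap1 : 0 < K + w ^+ 2 - q * C by move: etaE; rewrite /gap qC; lra.
have gap2 : 0 < b - `|a| / C.
  by rewrite subr_gt0 ltr_pdivrMr // bC ltrDl mulr_gt0.
(* Half of the minimum leaves both required inequalities strict. *)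
pose delta := Num.min (K + w ^+ 2 - q * C) (b - `|a| / C) / 2.
have m0 : 0 < Num.min (K + w ^+ 2 - q * C) (b - `|a| / C) by rewrite lt_min gap1.
have m1 : Num.min (K + w ^+ 2 - q * C) (b - `|a| / C) <= K + w ^+ 2 - q * C.
  by rewrite ge_min lexx.
have m2 : Num.min (K + w ^+ 2 - q * C) (b - `|a| / C) <= b - `|a| / C.
  by rewrite ge_min lexx orbT.
exists w, C, delta; split => //; rewrite ?divr_gt0 ?/delta //; first lra.
by rewrite -ltr_pdivrMr //; lra.
Qed.

(** * Supremum of the boundary data, and the final estimate *)

Lemma le_sup_norm_itv {R : realType} (d : R -> R) (t s : R) :
  {within `[0, +oo[, continuous d} -> 0 <= s <= t ->
  `|d s| <= sup [set `|d x| | x in `[0%R, t]].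
Proof.
(* [sup] is an upper bound only for a set that is bounded above; the maximum of [|d|] on the compact
   [0, t] provides this. *)
move=> cd st; apply: ub_le_sup; last by exists s; rewrite //= in_itv.
have cd' : {within `[0, t], continuous (fun x => `|d x|)}.
  apply/subspace_continuousP => x xt; apply: cvg_norm.
  have sub : `[0, t]%classic `<=` `[0, +oo[%classic.
    by move=> y; rewrite /= !in_itv /= => /andP[->].
  by have /subspace_continuousP := continuous_subspaceW sub cd; exact.
have t0 : 0 <= t by case/andP: st; exact: le_trans.
have [c _ cmax] := EVT_max t0 cd'.
by exists `|d c| => _ [x xt <-]; exact: cmax.
Qed.

Lemma norm_oo_ge0 {R : realType} (f : R -> R) : (0 <= norm_oo f)%E.
Proof. exact: Lnorm_ge0. Qed.

Theorem theorem2p2 (R : realType) (K r a b : R) (hb : 0 < b)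
    (hK : `|r * a| < K + pi ^+ 2) :
  exists M gamma delta : R, [/\ 0 < M, 0 < gamma, 0 < delta &
    forall u10 u20 d : R -> R,
      Ck 0 `[0, 1] u10 -> u10 1 = 0 ->
      Ck 1 `[0, 1] u20 ->
      Ck 0 `[0, +oo[ d -> d 0 = u10 0 ->
    forall u1 u2 : R -> R -> R,
      is_unique_solution K r a b u10 u20 d u1 u2 ->
    forall t : R, 0 <= t ->
      (norm_oo (u1 t) + norm_oo (u2 t) <=
       (M * expR (- (delta * t)))%:E * (norm_oo u10 + norm_oo u20)
       + (gamma * sup [set `|d s| | s in `[0%R, t]])%:E)%E].
Proof.
have [w [C [delta [wpi C0 delta0 KC aC]]]] := exists_weights _ _ _ _ hb hK.
set k := cos (w / 2); have k0 : 0 < k := cos_half_gt0 _ wpi.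
have gamma0 : 0 < (1 + C) / k by rewrite divr_gt0 //; lra.
have Cinv0 : 0 < 1 + C^-1 by rewrite addr_gt0 // invr_gt0.
have M0 : 0 < (1 + C^-1) * ((1 + C) / k) by rewrite mulr_gt0.
(* [1 + C] comes from adding the bounds for the two components, [1 / k] bounds [profile w], and
   [1 + C^-1] compares [N1 + N2 / C] with [N1 + N2] below. *)
exists ((1 + C^-1) * ((1 + C) / k)), ((1 + C) / k), delta; split => //.
move=> u10 u20 d [cu10 _] _ [cu20 _] [cd _] _ u1 u2 [sol _] t t0.
set D := sup _; set E := expR _.
have E0 : 0 < E by exact: expR_gt0.
have dD (s : R) : 0 <= s <= t -> `|d s| <= D by exact: le_sup_norm_itv.
have D0 : 0 <= D by apply: le_trans (dD 0 _) => //; rewrite lexx t0.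
have N1_ge z := norm_oo_ge u10 z cu10; have N2_ge z := norm_oo_ge u20 z cu20.
(* The norms are extended reals: an infinite norm of the initial data makes the right-hand side
   [+oo]. *)
have MEy : ((((1 + C^-1) * ((1 + C) / k) * E)%:E * +oo) + ((1 + C) / k * D)%:E = +oo)%E.
  by rewrite gt0_muley ?addye // lte_fin mulr_gt0.
move: (norm_oo_ge0 u10) N1_ge; case: (norm_oo u10) => [N1 N1_ge0 N1_ge| _ _|//]; last first.
  have N2_neq : norm_oo u20 != -oo%E.
    by rewrite -ltNye (lt_le_trans _ (norm_oo_ge0 u20)) // ltNy0.
  by rewrite addye // MEy leey.
move: (norm_oo_ge0 u20) N2_ge; case: (norm_oo u20) => [N2 N2_ge0 N2_ge| _ _|//]; last first.
  by rewrite addey // MEy leey.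
rewrite !lee_fin in N1_ge0 N2_ge0.
rewrite -(EFinD N1 N2) -EFinM -EFinD.
apply/lee_addgt0Pr => e e0.
(* [N] satisfies [N >= N1] and [C * N >= N2], so [G] and [C * G] dominate the initial data. The
   positive [eps] makes the bounds on the data strict and contributes exactly [e] to the final
   sum. *)
pose N := N1 + N2 / C; pose eps : R := e / ((1 + C) / k).
have eps0 : 0 < eps by rewrite divr_gt0.
have N0 : 0 <= N by rewrite addr_ge0 // divr_ge0 // ltW.
pose G s := N * expR (- (delta * s)) + (D + eps).
have dG (s : R) : is_derive s 1 G (- delta * (N * expR (- (delta * s)))).
  by apply: is_derive_eq; rewrite /GRing.scale /=; ring.
have NE (s : R) : 0 <= N * expR (- (delta * s)) by rewrite mulr_ge0 // expR_ge0.
have G0 (s : R) : 0 <= s -> 0 < G s by move=> _; have := NE s; rewrite /G; lra.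
have CN : C * N = C * N1 + N2 by rewrite /N; field; rewrite gt_eqF.
have cmp z : 0 <= z <= 1 -> `|u1 t z| <= G t * profile w z /\ `|u2 t z| <= C * G t * profile w z.
  (* The time horizon is [t] itself, since [D] is the supremum of [|d|] up to that time. *)
  apply: (comparison _ _ _ _ _ _ _ _ _ _ _ _ t _ _ sol wpi hb C0 KC aC dG G0) => //.
  - move=> s _; have : 0 <= delta * (D + eps) by rewrite mulr_ge0 ?(ltW delta0) //; lra.
    by rewrite /G; lra.
  - move=> y y01; have := N1_ge y y01; have := N2_ge y y01; rewrite !lee_fin => u2y u1y.
    rewrite /G mulr0 oppr0 expR0 mulr1 mulrDr CN; split.
      have : 0 <= N2 / C by rewrite divr_ge0 // ltW.
      by rewrite /N; lra.
    have : 0 <= C * N1 by rewrite mulr_ge0 // ltW.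
    have : 0 < C * (D + eps) by rewrite mulr_gt0 //; lra.
    by lra.
  - by move=> s st; have := NE s; have := dD s st; rewrite /G; lra.
  - by rewrite t0 lexx.
have Gt0 := G0 t t0.
have n1 : (norm_oo (u1 t) <= (G t / k)%:E)%E.
  apply: norm_oo_le => z z01; have [+ _] := cmp z z01 => /le_trans; apply.
  by rewrite ler_pM2l // profile_le.
have n2 : (norm_oo (u2 t) <= (C * G t / k)%:E)%E.
  apply: norm_oo_le => z z01; have [_ +] := cmp z z01 => /le_trans; apply.
  by rewrite ler_pM2l ?mulr_gt0 // profile_le.
apply: le_trans (leeD n1 n2) _; rewrite -!EFinD lee_fin.
have -> : G t / k + C * G t / k = (1 + C) / k * (N * E) + (1 + C) / k * D + e.
  by rewrite /G -/E /eps; field; rewrite !gt_eqF //; lra.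
rewrite !lerD2r.
have NM : N <= (1 + C^-1) * (N1 + N2).
  have -> : (1 + C^-1) * (N1 + N2) = N + (N2 + N1 / C) by rewrite /N; ring.
  by rewrite lerDl addr_ge0 // divr_ge0 // ltW.
have -> : (1 + C^-1) * ((1 + C) / k) * E * (N1 + N2) =
    (1 + C) / k * ((1 + C^-1) * (N1 + N2) * E) by ring.
by rewrite ler_pM2l // ler_pM2r.
Qed.
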